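(* Let $(\mathcal{R},\leq,r)$ be a triple satisfying the axioms \textbf{A1}, \textbf{A2}, \textbf{A3} and \textbf{A4}. Then a set $\mathcal{X}\subseteq\mathcal{R}$ is Kastanas Ramsey if and only if it is Ramsey.
   Context: $\mathcal{R}$ is a nonempty set, $\leq$ a quasi-order on $\mathcal{R}$, $\mathcal{AR}$ a set and $r:\mathcal{R}\times\omega\to\mathcal{AR}$ a function; write $r_n(A):=r(A,n)$ and $\mathcal{AR}_n:=\{r_n(A):A\in\mathcal{R}\}$. Axiom A1: (1) $r_0(A)=\emptyset$ for all $A\in\mathcal{R}$; (2) $A\neq B$ implies $r_n(A)\neq r_n(B)$ for some $n$; (3) $r_n(A)=r_m(B)$ implies $n=m$ and $r_k(A)=r_k(B)$ for all $k<n$. For $a\in\mathcal{AR}$, $\mathrm{lh}(a)$ is the unique $n$ with $a\in\mathcal{AR}_n$. Write $a\sqsubseteq b$ (for $a,b\in\mathcal{AR}$) if $a=r_m(A)$, $b=r_n(A)$ for some $A\in\mathcal{R}$ and $m\le n$. Axiom A2: there is a quasi-order $\leq_{\mathrm{fin}}$ on $\mathcal{AR}$ with (1) $\{a:a\leq_{\mathrm{fin}}b\}$ finite for every $b$; (2) $A\leq B$ iff $\forall n\,\exists m\,[r_n(A)\leq_{\mathrm{fin}}r_m(B)]$; (3) if $a\sqsubseteq b$ and $b\leq_{\mathrm{fin}}c$ then there is $d\sqsubseteq c$ with $a\leq_{\mathrm{fin}}d$. For $A\in\mathcal{R}$, $a\in\mathcal{AR}$: $[a,A]:=\{B\in\mathcal{R}:B\leq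 A,\ \exists n\,r_n(B)=a\}$, $[n,A]:=[r_n(A),A]$; $\mathrm{depth}_B(a):=\min\{n:a\leq_{\mathrm{fin}}r_n(B)\}$ (or $\infty$ if no such $n$); $\mathcal{AR}{\upharpoonright}A:=\{a:\exists n\,a\leq_{\mathrm{fin}}r_n(A)\}$; for $a\in\mathcal{AR}{\upharpoonright}A$, $r_n[a,A]:=\{b\in\mathcal{AR}{\upharpoonright}A:a\sqsubseteq b,\ \mathrm{lh}(b)=n\}$. Axiom A3: (1) if $\mathrm{depth}_B(a)<\infty$ then $[a,A]\neq\emptyset$ for all $A\in[\mathrm{depth}_B(a),B]$; (2) if $A\le B$ and $[a,A]\neq\emptyset$ then there is $A'\in[\mathrm{depth}_B(a),B]$ with $\emptyset\neq[a,A']\subseteq[a,A]$. Axiom A4: if $\mathrm{depth}_B(a)<\infty$ and $\mathcal{O}\subseteq\mathcal{AR}_{\mathrm{lh}(a)+1}$, there is $A\in[\mathrm{depth}_B(a),B]$ with $r_{\mathrm{lh}(a)+1}[a,A]\subseteq\mathcal{O}$ or $r_{\mathrm{lh}(a)+1}[a,A]\subseteq\mathcal{O}^c$. Ramsey: $\mathcal{X}\subseteq\mathcal{R}$ is Ramsey if for all $A\in\mathcal{R}$ and $a\in\mathcal{AR}{\upharpoonright}A$ there is $B\in[a,A]$ with $[a,B]\subseteq\mathcal{X}$ or $[a,B]\subseteq\mathcal{X}^c$. Kastanas game $K[a,A]$ ($A\in\mathcal{R}$, $a\in\mathcal{AR}{\upharpoonright}A$): set $a_0=a$, $B_{-1}=A$.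 In round $n\ge 0$, player I plays $A_n\in[a_n,B_{n-1}]$, then player II plays $a_{n+1}\in r_{\mathrm{lh}(a_n)+1}[a_n,A_n]$ and $B_n\in[a_{n+1},A_n]$. The outcome is the unique $B\in\mathcal{R}$ with $r_{\mathrm{lh}(a)+n}(B)=a_n$ for all $n$. A player has a strategy to reach $\mathcal{Y}$ if it has a strategy ensuring the outcome lies in $\mathcal{Y}$. Kastanas Ramsey: $\mathcal{X}$ is Kastanas Ramsey if for all $A\in\mathcal{R}$ and $a\in\mathcal{AR}{\upharpoonright}A$ there is $B\in[a,A]$ such that either I has a strategy in $K[a,B]$ to reach $\mathcal{X}^c$, or II has a strategy in $K[a,B]$ to reach $\mathcal{X}$.
   Formalization: The formal theorem additionally assumes that every complete legal run of the Kastanas game K[a,A] has an outcome in R; the definition of the game presupposes this, but A1–A4 do not imply it (e.g. R a nonprincipal ultrafilter on ω). *)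

(* Defs.v *)
From Stdlib Require Export RelationClasses.
From mathcomp Require Export all_boot.
From mathcomp Require Export boolp classical_sets functions cardinality.

Set Implicit Arguments.
Unset Strict Implicit.
Unset Printing Implicit Defensive.

Local Open Scope classical_set_scope.

(* [r A n] is r_n(A), [le] is the quasi-order on R and [lefin] the quasi-order
   on AR whose existence is asserted by A2. *)

Section Approximations.
Context {R AR : Type} (r : R -> nat -> AR).

Definition AR_ (n : nat) : set AR := [set a | exists A, r A n = a].

(* The unique n with [AR_ n a] under A1; the junk value 0 when [a] is not an
   approximation. *)
Definition lh (a : AR) : nat := get [set n | AR_ n a].

Definition initial (a b : AR) : Prop :=
  exists A m n, (m <= n)%N /\ a = r A m /\ b = r A n.

Definition A1 : Prop :=
  [/\ exists e : AR, forall A, r A 0 = e,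
      forall A B, A <> B -> exists n, r A n <> r B n &
      forall A B n m, r A n = r B m ->
        n = m /\ forall k, (k < n)%N -> r A k = r B k].

End Approximations.

Section Triple.
Context {R AR : Type}.
Variables (le : R -> R -> Prop) (r : R -> nat -> AR).
Variable lefin : AR -> AR -> Prop.

Definition A2 : Prop :=
  [/\ PreOrder lefin,
      forall b, finite_set [set a | lefin a b],
      forall A B, le A B <-> forall n, exists m, lefin (r A n) (r B m) &
      forall a b c, initial r a b -> lefin b c ->
        exists d, initial r d c /\ lefin a d].

Definition basic (a : AR) (A : R) : set R :=
  [set B | le B A /\ exists n, r B n = a].

Definition basicn (n : nat) (A : R) : set R := basic (r A n) A.

(* [None] stands for infinite depth. *)
Definition depth (B : R) (a : AR) : option nat :=
  match pselect (exists n, `[< lefin a (r B n) >]) with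
  | left h => Some (ex_minn h)
  | right _ => None
  end.

Definition ARup (A : R) : set AR := [set a | exists n, lefin a (r A n)].

Definition next (n : nat) (a : AR) (A : R) : set AR :=
  [set b | [/\ ARup A b, initial r a b & lh r b = n]].

Definition A3 : Prop :=
  (forall B a d, depth B a = Some d ->
     forall A, basicn d B A -> basic a A !=set0) /\
  (forall A B a, le A B -> basic a A !=set0 ->
     forall d, depth B a = Some d ->
     exists A', [/\ basicn d B A', basic a A' !=set0 &
                    basic a A' `<=` basic a A]).

Definition A4 : Prop :=
  forall B a d (O : set AR), depth B a = Some d -> O `<=` AR_ r (lh r a).+1 ->
  exists A, basicn d B A /\
    (next (lh r a).+1 a A `<=` O \/ next (lh r a).+1 a A `<=` ~` O).

Definition Ramsey (X : set R) : Prop :=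
  forall A a, ARup A a ->
  exists B, basic a A B /\ (basic a B `<=` X \/ basic a B `<=` ~` X).

(* A run of the game K[a,A] is a pair of sequences: [p n] is the move A_n of
   player I and [q n] the move (a_{n+1}, B_n) of player II.  Then
   [pos a A q n] is (a_n, B_{n-1}), with a_0 = a and B_{-1} = A. *)
Section Game.
Variables (a : AR) (A : R).

Definition pos (q : nat -> AR * R) (n : nat) : AR * R :=
  if n is k.+1 then q k else (a, A).

Definition legalI (p : nat -> R) (q : nat -> AR * R) (n : nat) : Prop :=
  basic (pos q n).1 (pos q n).2 (p n).

Definition legalII (p : nat -> R) (q : nat -> AR * R) (n : nat) : Prop :=
  next (lh r (pos q n).1).+1 (pos q n).1 (p n) (q n).1 /\
  basic (q n).1 (p n) (q n).2.

Definition outcome (q : nat -> AR * R) (B : R) : Prop :=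
  forall n, r B (lh r a + n) = (pos q n).1.

(* A strategy maps the finite sequence of the opponent's moves made so far to
   the next move.  It has to answer legally as long as the opponent has played
   legally. *)
Definition I_reaches (Y : set R) : Prop :=
  exists s : seq (AR * R) -> R, forall q : nat -> AR * R,
    let p n := s (mkseq q n) in
    (forall n, (forall m, (m < n)%N -> legalII p q m) -> legalI p q n) /\
    ((forall n, legalII p q n) -> exists B, outcome q B /\ Y B).

Definition II_reaches (Y : set R) : Prop :=
  exists t : seq R -> AR * R, forall p : nat -> R,
    let q n := t (mkseq p n.+1) in
    (forall n, (forall m, (m <= n)%N -> legalI p q m) -> legalII p q n) /\
    ((forall n, legalI p q n) -> exists B, outcome q B /\ Y B).

End Game.

(* The definition of the game presupposes that each run has an outcome in R.
   A1-A4 do not imply this (take R a nonprincipal ultrafilter on omega, with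
   inclusion and finite initial segments).  It holds whenever R is closed in
   the space of sequences of approximations.  Uniqueness follows from A1. *)
Definition outcomes_exist : Prop :=
  forall A a, ARup A a ->
  forall (p : nat -> R) (q : nat -> AR * R),
    (forall n, legalI a A p q n) -> (forall n, legalII a A p q n) ->
    exists B, outcome a A q B.

Definition KastanasRamsey (X : set R) : Prop :=
  forall A a, ARup A a ->
  exists B, basic a A B /\ (I_reaches a B (~` X) \/ II_reaches a B X).

End Triple.

(* Main.v *)
(** If one side of the dichotomy in the Ramsey property holds on [a,B], then the
    corresponding player wins K[a,B] by copying moves, because every outcome
    lies in [a,B].  Conversely, a winning strategy is spread over a whole basic
    set by fusion: one builds C such that every approximation b in AR|C
    extending a carries a history of the game arriving at b, histories of
    successive approximations extending each other.  Every member of [a,C] is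
    then the outcome of a run that follows the strategy.  For a strategy of I
    the fusion step needs only A3(2).  For a strategy of II, a first fusion
    decides, for each b' of the next length, whether II can be induced to answer
    b' inside every smaller set; A4 makes the decision uniform, and a negative
    one is refuted by letting I play inside the homogeneous set. *)
Require Import Defs.

Set Implicit Arguments.
Unset Strict Implicit.
Unset Printing Implicit Defensive.

Local Open Scope classical_set_scope.

(** * Finite histories and infinite runs *)

Section Histories.
Context {T : Type}.
Implicit Types (L : seq T -> T -> Prop) (h : seq T) (q : nat -> T).

(** [L h x] is read as legality of [x] after [h]. Quantifying over splittings keeps the notion on
    finite lists, whereas the rules of the game speak of infinite sequences. *)
Definition plays L h : Prop := forall h1 x h2, h = h1 ++ x :: h2 -> L h1 x.

Lemma plays_nil L : plays L [::].
Proof. by case. Qed.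

Lemma plays_rcons L h x : plays L h -> L h x -> plays L (rcons h x).
Proof.
move=> Lh Lhx h1 y h2; case/lastP: h2 => [|h2 z].
  by rewrite cats1 => /rcons_inj[<- <-].
rewrite -rcons_cons -rcons_cat => /rcons_inj[+ _]; exact: Lh.
Qed.

Lemma plays_mkseq L q n :
  plays L (mkseq q n) <-> forall m, m < n -> L (mkseq q m) (q m).
Proof.
elim: n => [|n IH]; first by split=> // _; exact: plays_nil.
rewrite mkseqS; split=> [Lq m|Lq].
  rewrite ltnS leq_eqVlt => /predU1P[->|]; first by apply: (Lq _ _ [::]); rewrite cats1.
  move: m; apply/IH => h1 x h2 e; apply: (Lq _ _ (rcons h2 (q n))).
  by rewrite e rcons_cat.
apply: plays_rcons; last exact: Lq.
by apply/IH => m mn; apply: Lq; exact: ltnW.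
Qed.

Lemma history_nth h (x0 : T) : exists q, h = mkseq q (size h).
Proof. by exists (nth x0 h); rewrite mkseq_nth. Qed.

Lemma history_branch (h : nat -> seq T) : h 0 = [::] ->
  (forall n, exists x, h n.+1 = rcons (h n) x) ->
  exists q, forall n, h n = mkseq q n.
Proof.
move=> h0 /choice[q hq]; exists q; elim=> [|n IH]; first by rewrite h0.
by rewrite hq IH mkseqS.
Qed.

End Histories.


(** * Approximations, basic sets and depth *)

Section RamseySpace.
Context {R AR : Type} {le : R -> R -> Prop} {r : R -> nat -> AR}.
Context {lefin : AR -> AR -> Prop}.
Context (hle : PreOrder le) (hA1 : A1 r) (hA2 : A2 le r lefin).

Notation basic := (basic le r).
Notation basicn := (basicn le r).
Notation ARup := (ARup r lefin).
Notation next := (next r lefin).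
Notation depth := (depth r lefin).

Let le_refl A : le A A. Proof. exact: PreOrder_Reflexive. Qed.
Let le_trans A B C : le A B -> le B C -> le A C.
Proof. exact: PreOrder_Transitive. Qed.
Let lefin_refl a : lefin a a.
Proof. by case: hA2 => -[h _] _ _ _; exact: h. Qed.
Let lefin_trans a b c : lefin a b -> lefin b c -> lefin a c.
Proof. by case: hA2 => -[_ h] _ _ _; exact: h. Qed.

Lemma approx_inj A B m n : r A m = r B n -> m = n.
Proof. by case: hA1 => _ _ h /h[]. Qed.

Lemma approx_restrict A B m n k : r A m = r B n -> k <= m -> r A k = r B k.
Proof.
case: hA1 => _ _ h e; have [emn H] := h _ _ _ _ e.
by rewrite leq_eqVlt => /predU1P[->|/H//]; rewrite e emn.
Qed.

Lemma eq_of_approx A B : (forall n, r A n = r B n) -> A = B.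
Proof.
case: hA1 => _ h _ e; apply: contrapT => /h[n]; exact.
Qed.

Lemma lh_approx A n : lh r (r A n) = n.
Proof.
rewrite /lh; case: (@getPex _ [set k | AR_ r k (r A n)]) => [|B /approx_inj//].
by exists n, A.
Qed.

Lemma initial_approx A m n : m <= n -> initial r (r A m) (r A n).
Proof. by move=> mn; exists A, m, n. Qed.

(** A1(3) makes the witness in [initial] irrelevant: any set passing through the longer
    approximation passes through the shorter one. *)
Lemma initialP a B n :
  initial r a (r B n) <-> exists2 m, m <= n & a = r B m.
Proof.
split=> [[A [m [k [mk [-> e]]]]]|[m mn ->]]; last exact: initial_approx.
by exists m; [rewrite (approx_inj e)|exact: (approx_restrict (esym e))].
Qed.

Lemma initial_exists a b : initial r a b ->
  exists A k, a = r A (lh r a) /\ b = r A (lh r a + k).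
Proof.
move=> [A [m [n [mn [-> ->]]]]]; exists A, (n - m).
by rewrite lh_approx subnKC.
Qed.

Lemma basicP a A B : AR_ r (lh r a) a ->
  basic a A B <-> le B A /\ r B (lh r a) = a.
Proof.
move=> [D Da]; split=> [[? [n <-]]|[? e]]; first by rewrite lh_approx.
by split=> //; exists (lh r a).
Qed.

Lemma basicnP n A B : basicn n A B <-> le B A /\ r B n = r A n.
Proof.
have h : AR_ r (lh r (r A n)) (r A n) by exists A; rewrite lh_approx.
by rewrite /Defs.basicn (basicP _ _ h) lh_approx.
Qed.

Lemma basic_AR a A B : basic a A B -> AR_ r (lh r a) a.
Proof. by move=> [_ [n <-]]; exists B; rewrite lh_approx. Qed.

Lemma basic_lh a A B : basic a A B -> r B (lh r a) = a.
Proof. by move=> h; move: (h) => /basicP-[]//; exact: basic_AR h. Qed.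

Lemma basic_le a A B : basic a A B -> le B A.
Proof. by case. Qed.

Lemma basicS a A B : le A B -> basic a A `<=` basic a B.
Proof. by move=> AB C [CA h]; split => //; exact: le_trans AB. Qed.

Lemma le_approx A B n : le A B -> exists m, lefin (r A n) (r B m).
Proof. by case: hA2 => _ _ h _ /h. Qed.

Lemma ARup_le a A B : le A B -> ARup A a -> ARup B a.
Proof.
move=> AB [n an]; have [m nm] := le_approx n AB.
by exists m; exact: lefin_trans nm.
Qed.

Lemma ARup_approx A n : ARup A (r A n).
Proof. by exists n. Qed.

Lemma basic_ARup a A B : basic a A B -> ARup A a.
Proof. by move=> [BA [n <-]]; exact: ARup_le BA (ARup_approx _ _). Qed.

Lemma lefin_initial a b C n : initial r a b -> lefin b (r C n) ->
  exists2 m, m <= n & lefin a (r C m).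
Proof.
case: hA2 => _ _ _ h /h{}h /h[d [/initialP[m mn ->] ad]].
by exists m.
Qed.

Lemma ARup_initial a b A : initial r a b -> ARup A b -> ARup A a.
Proof. by move=> ab [n /(lefin_initial ab)[m _ am]]; exists m. Qed.

(** By A2(3), membership in [ARup B] passes down to initial segments. *)
Lemma le_cofinal A B :
  (forall n, exists2 m, n <= m & ARup B (r A m)) -> le A B.
Proof.
move=> h; case: hA2 => _ _ -> _ n; have [m nm Bm] := h n.
exact: ARup_initial (initial_approx A nm) Bm.
Qed.

Lemma nextS n a A B : le A B -> next n a A `<=` next n a B.
Proof. by move=> AB b [? ? ?]; split=> //; exact: ARup_le AB _. Qed.

Lemma nextP a A B : basic a A B -> next (lh r a).+1 a A (r B (lh r a).+1).
Proof.
move=> aAB; split; last by rewrite lh_approx.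
- exact: ARup_le (basic_le aAB) (ARup_approx _ _).
- by rewrite -{1}(basic_lh aAB); exact: initial_approx.
Qed.

Lemma basic_next a b A : initial r a b -> basic b A `<=` basic a A.
Proof.
move=> ab B bAB; split; first exact: basic_le bAB.
by move: ab; rewrite -(basic_lh bAB) => /initialP[m _ ->]; exists m.
Qed.

Lemma depthP B a d : depth B a = Some d <->
  lefin a (r B d) /\ forall m, m < d -> ~ lefin a (r B m).
Proof.
rewrite /Defs.depth; case: pselect => [h|h]; last first.
  by split=> // -[ad _]; case: h; exists d; apply/asboolP.
case: ex_minnP => m /asboolP am mmin; split=> [[<-]|[ad dmin]].
  by split=> // k km /asboolP/mmin; rewrite leqNgt km.
congr Some; apply/eqP; rewrite eqn_leq (mmin d) ?andTb; last exact/asboolP.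
by rewrite leqNgt; apply/negP => /dmin.
Qed.

Lemma ARup_depth B a : ARup B a -> exists d, depth B a = Some d.
Proof.
rewrite /Defs.depth; case: pselect => [h|h [n an]]; first by eexists.
by case: h; exists n; apply/asboolP.
Qed.

Lemma depth_basicn d B A a :
  basicn d B A -> depth B a = Some d -> depth A a = Some d.
Proof.
move=> /basicnP[_ e] /depthP[ad dmin]; apply/depthP; rewrite e.
by split=> // m md; rewrite (approx_restrict e (ltnW md)); exact: dmin.
Qed.

Lemma basicn_refl d A : basicn d A A.
Proof. by apply/basicnP. Qed.

Lemma basicn_le d A B : basicn d A B -> le B A.
Proof. by case. Qed.

Lemma basicn_trans d A B C : basicn d A B -> basicn d B C -> basicn d A C.
Proof.
move=> /basicnP[BA eB] /basicnP[CB eC]; apply/basicnP.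
by rewrite eC eB; split=> //; exact: le_trans BA.
Qed.

(** * Consequences of A3 and limits of fusion sequences *)

Context (hA3 : A3 le r lefin).

Lemma basic_nonempty a A : ARup A a -> basic a A !=set0.
Proof.
move=> /ARup_depth[d Aa]; case: hA3 => + _ => /(_ _ _ _ Aa); apply.
exact: basicn_refl.
Qed.

Lemma basic_refine a A B d : le A B -> basic a A !=set0 -> depth B a = Some d ->
  exists A', [/\ basicn d B A', basic a A' !=set0 & basic a A' `<=` basic a A].
Proof. by case: hA3 => _ h AB /(h _ _ _ AB); exact. Qed.

Context (hout : outcomes_exist le r lefin).

(* The C_n are the moves of a run of K[r_d(C_0),C_0]; its outcome is the limit. *)
Lemma fusion_limit (C : nat -> R) d :
  (forall n, basicn (d + n) (C n) (C n.+1)) ->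
  exists D, forall n, basicn (d + n) (C n) D.
Proof.
move=> CS.
pose p n := C n.+1; pose q n := (r (C n.+1) (d + n.+1), C n.+1).
have posE n : pos (r (C 0) d) (C 0) q n = (r (C n) (d + n), C n).
  by case: n => [|n] //=; rewrite addn0.
have CSe n : r (C n.+1) (d + n) = r (C n) (d + n) by move/basicnP: (CS n) => [].
have [D Dout] : exists D, outcome r (r (C 0) d) (C 0) q D.
  apply: (hout (ARup_approx _ _) (p := p)) => n.
    by rewrite /legalI posE; exact: CS.
  rewrite /legalII posE /=; split; last exact: basicn_refl.
  split; first exact: ARup_approx.
    by rewrite -CSe addnS; apply: initial_approx; exact: leqnSn.
  by rewrite !lh_approx addnS.
have {}Dout n : r D (d + n) = r (C n) (d + n).
  by have := Dout n; rewrite lh_approx posE.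
have Cle m n : m <= n -> le (C n) (C m).
  elim: n => [|n IH]; first by rewrite leqn0 => /eqP->.
  rewrite leq_eqVlt => /predU1P[->//|/IH]; apply: le_trans.
  exact: basicn_le (CS n).
exists D => n; apply/basicnP; split => //; apply: le_cofinal => k.
(* The index is past [k] for cofinality and past stage [n], so that this approximation of [D] comes
   from a set below [C n]. *)
exists (d + maxn k n); first by apply: leq_trans (leq_maxl k n) (leq_addl _ _).
rewrite Dout; apply: ARup_le (Cle n _ (leq_maxr k n)) _; exact: ARup_approx.
Qed.

(** * Fusion with histories *)

Section Fusion.
(** [W b h C] is the invariant that [h] arrives at [b] and can be continued inside [C]. [Wstep]
    serves one new approximation without disturbing [C] up to its depth. *)
Context {H : Type} (W : AR -> H -> R -> Prop) (succ : H -> H -> Prop).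
Context (a : AR) (h0 : H).
Context (Wle : forall b h C C', le C' C -> W b h C -> W b h C').
Context (Wstep : forall b h C b' d,
  W b h C -> next (lh r b).+1 b C b' -> depth C b' = Some d ->
  exists h' C', [/\ succ h h', basicn d C C' & W b' h' C']).

(* G is the graph of a partial map assigning histories to approximations. *)
Record valid (C : R) (G : AR -> H -> Prop) : Prop := {
  valid_root : G a h0;
  valid_fun : forall b h h', G b h -> G b h' -> h = h';
  valid_W : forall b h, G b h -> W b h C;
  valid_succ : forall b b' h', G b' h' -> initial r a b -> initial r b b' ->
    lh r b' = (lh r b).+1 -> exists2 h, G b h & succ h h' }.

(** The bound is strict: approximations of depth exactly [e] can still be served while [r C e] stays
    fixed. *)
Definition covers e (C : R) (G : AR -> H -> Prop) : Prop :=
  forall b m, m < e -> initial r a b -> lefin b (r C m) -> exists h, G b h.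

Definition extends e (C : R) (G : AR -> H -> Prop) C' G' : Prop :=
  basicn e C C' /\ forall b h, G b h -> G' b h.

Lemma extends_refl e C G : extends e C G C G.
Proof. by split=> //; exact: basicn_refl. Qed.

Lemma extends_trans e C G C' G' C'' G'' :
  extends e C G C' G' -> extends e C' G' C'' G'' -> extends e C G C'' G''.
Proof.
move=> [C1 G1] [C2 G2]; split=> [|b h /G1/G2//]; exact: basicn_trans C2.
Qed.

Lemma basicn_approx e C C' m : basicn e C C' -> m <= e -> r C' m = r C m.
Proof. by move=> /basicnP[_ ee]; exact: approx_restrict ee. Qed.

Lemma covers_extends e C G C' G' :
  extends e C G C' G' -> covers e C G -> covers e C' G'.
Proof.
move=> [CC' GG'] cov b m me ab; rewrite (basicn_approx CC' (ltnW me)) => bC.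
by have [h /GG'] := cov _ _ me ab bC; exists h.
Qed.

(** Induction along the chain from [a]: A2(3) puts each predecessor below an approximation of [C] of
    no larger index, so it gets a history first. *)
Lemma cover_one e C G D n m : valid C G -> covers e C G -> a = r D (lh r a) ->
  m <= e -> lefin (r D (lh r a + n)) (r C m) ->
  exists C' G', [/\ extends e C G C' G', valid C' G' &
    exists h, G' (r D (lh r a + n)) h].
Proof.
move=> + + aD; elim: n C G m => [|n IH] C G m vG cov me bC.
  exists C, G; split=> //; first exact: extends_refl.
  by exists h0; rewrite addn0 -aD; exact: valid_root vG.
move: bC; rewrite addnS; set b' := r D _.+1 => bC.
pose b := r D (lh r a + n).
have bb' : initial r b b' by apply: initial_approx; exact: leqnSn.
have lb' : lh r b' = (lh r b).+1 by rewrite !lh_approx.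
have ab' : initial r a b'.
  by rewrite aD; apply: initial_approx; rewrite -addnS leq_addr.
have [m' mm' bC'] := lefin_initial bb' bC.
have [C1 [G1 [ext1 v1 [h G1b]]]] := IH _ _ _ vG cov (leq_trans mm' me) bC'.
have cov1 := covers_extends ext1 cov.
have [[h' G1b']|nG1] := pselect (exists h', G1 b' h').
  by exists C1, G1; split=> //; exists h'.
have bC1 : lefin b' (r C1 m) by case: ext1 => /basicn_approx->.
(* An approximation without a history cannot have depth below [e], so its depth is exactly [e] and
   [Wstep] preserves [r C1 e]. *)
have me' : m = e.
  apply/eqP; move: me; rewrite leq_eqVlt => /predU1P[->//|me].
  by case: nG1; exact: cov1 me ab' bC1.
have dC1 : depth C1 b' = Some e.
  apply/depthP; split=> [|k ke bk]; first by rewrite -me'.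
  by apply: nG1; exact: cov1 ke ab' bk.
have bn : next (lh r b).+1 b C1 b' by split=> //; exists m.
have [h' [C2 [hh' C12 Wb']]] := Wstep (valid_W v1 G1b) bn dC1.
exists C2, (fun c k => G1 c k \/ c = b' /\ k = h'); split; last by exists h'; right.
  by apply: extends_trans ext1 _; split=> // c k; left.
split.
- by left; exact: valid_root v1.
- move=> c k k' [G1k|[-> ->]] [G1k'|[ec ->]] //.
  + exact: valid_fun v1 _ _ _ G1k G1k'.
  + by case: nG1; exists k; rewrite -ec.
  + by case: nG1; exists k'.
- move=> c k [/(valid_W v1)|[-> ->]//]; apply: Wle; exact: basicn_le C12.
(* The only immediate predecessor of the new entry [b'] is [b], which carries [h]. *)
- move=> c c' k' [G1k' ac cc' lc'|[-> ->] ac /initialP[j _ ec]].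
    by have [k] := valid_succ v1 G1k' ac cc' lc'; exists k => //; left.
  rewrite lb' ec !lh_approx => -[<-]; exists h => //; left; exact: G1b.
Qed.

(** By A2(1) only finitely many approximations lie below [r C e]; they are served one after another,
    [r C e] staying fixed throughout. *)
Lemma cover_stage e C G : valid C G -> covers e C G ->
  exists C' G', [/\ extends e C G C' G', valid C' G' & covers e.+1 C' G'].
Proof.
move=> vG cov; have fin : finite_set [set b | lefin b (r C e)] by case: hA2.
have /(@finite_seqP {classic AR})[s sE] := fin.
have [C' [G' [ext v' s']]] : exists C' G', [/\ extends e C G C' G', valid C' G' &
    forall b, b \in s -> initial r a b -> exists h, G' b h].
  (* The induction runs over a sublist of [s], so that its members are still known to lie below
     [r C e]. *)
  have : {subset s <= s} by [].
  elim: {1 3}s => [_|b t IH sub].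
    by exists C, G; split=> //; exact: extends_refl.
  have [|C1 [G1 [ext1 v1 t1]]] := IH; first by move=> c ct; apply: sub; rewrite inE ct orbT.
  have [ab|nab] := pselect (initial r a b); last first.
    exists C1, G1; split=> // c; rewrite inE => /predU1P[->//|]; exact: t1.
  have [D [n [aD bD]]] := initial_exists ab.
  have bC1 : lefin b (r C1 e).
    case: ext1 => /basicn_approx-> // _.
    suff : [set` s] b by rewrite -sE.
    by apply: sub; rewrite inE eqxx.
  rewrite bD in bC1.
  have [C2 [G2 [ext2 v2 G2b]]] :=
    cover_one v1 (covers_extends ext1 cov) aD (leqnn e) bC1.
  exists C2, G2; split=> //; first exact: extends_trans ext1 ext2.
  move=> c; rewrite inE => /predU1P[->|ct] ac; first by rewrite bD.
  by have [h G1h] := t1 _ ct ac; exists h; case: ext2 => _; exact.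
exists C', G'; split=> // b m; rewrite ltnS leq_eqVlt => /predU1P[->|me] ab bC'.
  apply: s' => //; suff : [set` s] b by [].
  by rewrite -sE /=; case: ext => /basicn_approx <-.
exact: covers_extends ext cov _ _ me ab bC'.
Qed.

(** Stage [n] fixes the approximation at [d + n], so the sets have a limit by [fusion_limit]; the
    graphs increase, so their union is again a function. *)
Lemma fusion C0 d : depth C0 a = Some d -> W a h0 C0 ->
  exists C f, [/\ basicn d C0 C, f a = h0 &
    forall b, initial r a b -> ARup C b -> W b (f b) C /\
      forall b', next (lh r b).+1 b C b' -> succ (f b) (f b')].
Proof.
move=> dC0 W0.
pose good n (x : R * (AR -> H -> Prop)) := valid x.1 x.2 /\ covers (d + n) x.1 x.2.
have /choice[F FP] : forall nx : nat * (R * (AR -> H -> Prop)), exists y,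
    good nx.1 nx.2 -> extends (d + nx.1) nx.2.1 nx.2.2 y.1 y.2 /\ good nx.1.+1 y.
  move=> [n [C G]]; have [[vG cov]|ng] := pselect (good n (C, G)); last first.
    by exists (C, G).
  have [C' [G' [? ? ?]]] := cover_stage vG cov.
  by exists (C', G') => _; split=> //; split=> //=; rewrite addnS.
pose G0 b h := b = a /\ h = h0.
pose x := fix x n := if n is k.+1 then F (k, x k) else (C0, G0).
have gx n : good n (x n).
  elim: n => [|n IH]; last by case: (FP (n, x n) IH).
  (* Initially there is nothing to cover: an extension of [a] below [r C0 m] with [m < d] would give
     [a] depth less than [d]. *)
  split=> [|b m]; last first.
    rewrite addn0 => md ab bm; have [j jm aj] := lefin_initial ab bm.
    by move/depthP: dC0 => -[_ /(_ j (leq_ltn_trans jm md))].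
  split=> //=.
  - by move=> b h h' [_ ->] [_ ->].
  - by move=> b h [-> ->].
  (* Vacuous: [b] would extend [a] and yet be shorter. *)
  - move=> b b' h' [-> _] ab [D [i [j [ij [eb ea]]]]].
    move: ab; rewrite ea eb !lh_approx => /initialP[k ki] /approx_inj ejk ei.
    by move: ki ij; rewrite -ejk ei ltnn.
have xS n : extends (d + n) (x n).1 (x n).2 (x n.+1).1 (x n.+1).2.
  by case: (FP (n, x n) (gx n)).
have [C CP] := @fusion_limit (fun n => (x n).1) d (fun n => (xS n).1).
have Gmono m n b h : m <= n -> (x m).2 b h -> (x n).2 b h.
  elim: n => [|n IH]; first by rewrite leqn0 => /eqP->.
  by rewrite leq_eqVlt => /predU1P[->//|/IH{}IH /IH]; exact: (xS n).2.
(* The premises sit under the existential so that choice gives a total function, with value [h0] off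
   the relevant approximations. *)
have tot b : exists h, initial r a b -> ARup C b -> exists n, (x n).2 b h.
  have [[ab [m bm]]|nb] := pselect (initial r a b /\ ARup C b); last first.
    by exists h0 => ab bC; case: nb.
  have [_ cov] := gx m.+1.
  have mm : m < d + m.+1 by rewrite addnS ltnS leq_addl.
  have [|h Gh] := cov b m mm ab; last by exists h => _ _; exists m.+1.
  by rewrite -(basicn_approx (CP m.+1) (ltnW mm)).
have [f fP] := choice tot.
have Gfun m n b h h' : (x m).2 b h -> (x n).2 b h' -> h = h'.
  move=> /(Gmono _ (maxn m n)) Gm /(Gmono _ (maxn m n)) Gn.
  by apply: valid_fun (gx (maxn m n)).1 _ _ _ (Gm _) (Gn _); rewrite ?leq_maxl ?leq_maxr.
have aC : ARup C a.
  have /basicn_approx/(_ (leq_addr 0 d)) := CP 0.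
  by move/depthP: dC0 => -[ad _] e; exists d; rewrite e.
exists C, f; split.
- by have := CP 0; rewrite addn0.
- have aa : initial r a a.
    have [D Da] := basic_nonempty aC; rewrite -(basic_lh Da).
    exact: initial_approx.
  have [n Gn] := fP a aa aC; apply: Gfun Gn _; exact: valid_root (gx 0).1.
- move=> b ab bC; have [n Gn] := fP b ab bC; split.
    by apply: Wle (valid_W (gx n).1 Gn); exact: basicn_le (CP n).
  move=> b' [b'C bb' lb'].
  have ab' : initial r a b'.
    case: bb' => D [i [j [ij [eb ->]]]]; move: ab; rewrite eb => /initialP[k ki ->].
    by apply: initial_approx; exact: leq_trans ki ij.
  have [n' Gn'] := fP b' ab' b'C.
  have [h Gh sh] := valid_succ (gx n').1 Gn' ab bb' lb'.
  by rewrite (Gfun _ _ _ _ _ Gn Gh).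
Qed.

End Fusion.

(** Fusion with trivial histories makes a dense, downward closed property hold at all extensions of
    [a] simultaneously. *)
Lemma fusion_dense (P : AR -> R -> Prop) a C0 d :
  (forall b C C', le C' C -> P b C -> P b C') ->
  (forall b C e, depth C b = Some e -> exists C', basicn e C C' /\ P b C') ->
  depth C0 a = Some d ->
  exists C, basicn d C0 C /\ forall b, initial r a b -> ARup C b -> P b C.
Proof.
move=> Ple Pdense aC0; have [C1 [C01 P1]] := Pdense _ _ _ aC0.
have [] := @fusion unit (fun b _ => P b) (fun _ _ => True) a tt _ _ C1 d => //.
- by move=> b _; exact: Ple.
- move=> b _ C b' e _ _ /Pdense[C' [CC' Pb']].
  by exists tt, C'; split.
- exact: depth_basicn C01 aC0.
move=> C [_ [C1C _ CP]]; exists C; split; first exact: basicn_trans C1C.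
by move=> b ab bC; case: (CP b ab bC).
Qed.

(** When histories grow by one move at a time, those along the approximations of [D] form a branch,
    which is an infinite run. *)
Lemma fusion_branches T (W : AR -> seq T -> R -> Prop) a C0 d :
  (forall b h C C', le C' C -> W b h C -> W b h C') ->
  (forall b h C b' e, W b h C -> next (lh r b).+1 b C b' ->
    depth C b' = Some e ->
    exists x C', basicn e C C' /\ W b' (rcons h x) C') ->
  depth C0 a = Some d -> W a [::] C0 ->
  exists C, basicn d C0 C /\ forall D, basic a C D ->
    exists q, forall n, W (r D (lh r a + n)) (mkseq q n) C.
Proof.
move=> Wle Wstep aC0 W0.
have [|C [f [C0C fa fP]]] :=
  fusion (succ := fun h h' => exists x, h' = rcons h x) Wle _ aC0 W0.
  move=> b h C b' e Wb bb' bC; have [x [C' [CC' Wb']]] := Wstep _ _ _ _ _ Wb bb' bC.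
  by exists (rcons h x), C'; split=> //; exists x.
exists C; split=> // D aD.
have init n : initial r a (r D (lh r a + n)).
  by rewrite -{1}(basic_lh aD); apply: initial_approx; exact: leq_addr.
have upC n : ARup C (r D n) by exact: ARup_le (basic_le aD) (ARup_approx _ _).
have [||q qP] := @history_branch T (fun n => f (r D (lh r a + n))).
- by rewrite addn0 (basic_lh aD) fa.
- move=> n; have [_] := fP _ (init n) (upC _); apply; split => //.
    by rewrite addnS; apply: initial_approx; exact: leqnSn.
  by rewrite !lh_approx addnS.
by exists q => n; rewrite -qP; case: (fP _ (init n) (upC _)).
Qed.

(** * Outcomes, and spreading a strategy of player I *)

Lemma outcome_unique a A D E (q : nat -> AR * R) :
  (forall n, (pos a A q n).1 = r D (lh r a + n)) -> outcome r a A q E -> E = D.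
Proof.
move=> qD qE; apply: eq_of_approx => n.
have e : r E (lh r a + n) = r D (lh r a + n) by rewrite qE qD.
exact: approx_restrict e (leq_addl _ _).
Qed.

(** Every position keeps its set below [A], so all the long approximations of the outcome lie in
    [ARup A]. *)
Lemma basic_of_outcome a A D (p : nat -> R) (q : nat -> AR * R) : basic a A A ->
  (forall n, legalI le r a A p q n) -> (forall n, legalII le r lefin a A p q n) ->
  outcome r a A q D -> basic a A D.
Proof.
move=> aA Ip IIq Dq.
have posA n : le (pos a A q n).2 A.
  elim: n => [|n IH] //=; apply: le_trans IH.
  exact: le_trans (basic_le (IIq n).2) (basic_le (Ip n)).
have Da : r D (lh r a) = a by have := Dq 0; rewrite addn0.
split; last by exists (lh r a).
apply: le_cofinal => n; exists (lh r a + n); first exact: leq_addl.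
by rewrite Dq; apply: ARup_le (posA n) _; exact: basic_ARup (Ip n).
Qed.

Lemma Ramsey_of_I_reaches a A d Y : basic a A A -> depth A a = Some d ->
  I_reaches le r lefin a A Y ->
  exists C, basicn d A C /\ basic a C `<=` Y.
Proof.
move=> aA Ad [s sP].
pose cur h := last (a, A) h.
pose L h x := next (lh r (cur h).1).+1 (cur h).1 (s h) x.1 /\ basic x.1 (s h) x.2.
have posE q n : pos a A q n = cur (mkseq q n).
  by case: n => [|n] //; rewrite mkseqS /cur last_rcons.
have sL h : plays L h -> basic (cur h).1 (cur h).2 (s h).
  have [q ->] := history_nth h (a, A); move=> /plays_mkseq Lq.
  have [+ _] := sP q; move=> /(_ (size h)); rewrite /legalI posE; apply.
  by move=> m /Lq; rewrite /legalII posE.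
(* Histories list the moves of II. The inclusion keeps every continuation through [b] inside the
   answer of I. *)
pose W b h C := [/\ plays L h, (cur h).1 = b & basic b C `<=` basic b (s h)].
have refine h C e : plays L h -> le (cur h).2 C -> depth C (cur h).1 = Some e ->
    exists C', basicn e C C' /\ W (cur h).1 h C'.
  move=> Lh hC bC; have sh := sL _ Lh.
  have [||C' [CC' _ C's]] := basic_refine _ _ bC (A := s h).
  - exact: le_trans (basic_le sh) hC.
  - by exists (s h); split=> //; exists (lh r (cur h).1); exact: basic_lh sh.
  by exists C'.
have [C0 [AC0 W0]] := refine [::] A d (@plays_nil _ _) (le_refl _) Ad.
have [||C [C0C CP]] := @fusion_branches _ W a C0 d _ _ (depth_basicn AC0 Ad) W0.
- move=> b h C C' C'C [Lh hb bC]; split=> // B bB; apply: bC.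
  exact: basicS C'C _ bB.
- move=> b h C b' e [Lh hb bC] [b'C bb' lb'] Cb'.
  (* II may play [b'] with any [B'] in [[b',C]]: the inclusion in [W] makes this legal, and [B']
     being below [C] allows the next refinement. *)
  have [B' b'B'] := basic_nonempty b'C.
  have sB' := bC _ (basic_next bb' b'B').
  have b's : basic b' (s h) B' by split; [exact: basic_le sB'|exact: b'B'.2].
  have Lx : L h (b', B').
    by rewrite /L hb; split=> //; split=> //; exact: basic_ARup b's.
  have := @refine (rcons h (b', B')) C e (plays_rcons Lh Lx).
  rewrite /cur last_rcons => /(_ (basic_le b'B') Cb')[C' []].
  by exists (b', B'), C'.
exists C; split; first exact: basicn_trans C0C.
move=> D /CP[q qP]; have [_ []] := sP q.
  move=> n; rewrite /legalII posE.
  by have [/plays_mkseq/(_ n (ltnSn n))] := qP n.+1.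
move=> E [qE YE]; suff <- : E = D by [].
by apply: outcome_unique qE => n; rewrite posE; case: (qP n).
Qed.

(** * Spreading a strategy of player II *)

Context (hA4 : A4 le r lefin).

(** Histories list the moves of I. Since II picks the next approximation, the invariant must ensure
    that each possible [b'] can be provoked from II. *)
Lemma Ramsey_of_II_reaches a A d Y : basic a A A -> depth A a = Some d ->
  II_reaches le r lefin a A Y ->
  exists C, basicn d A C /\ basic a C `<=` Y.
Proof.
move=> aA Ad [t tP].
(* II answers nonempty lists only, so the initial position is a separate case. *)
pose cur h := if h is [::] then (a, A) else t h.
pose L h x := basic (cur h).1 (cur h).2 x.
have cur_rcons h x : cur (rcons h x) = t (rcons h x) by case: h.
have posE p n : pos a A (fun n => t (mkseq p n.+1)) n = cur (mkseq p n).
  by case: n.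
have tL h x : plays L h -> L h x ->
    next (lh r (cur h).1).+1 (cur h).1 x (t (rcons h x)).1 /\
    basic (t (rcons h x)).1 x (t (rcons h x)).2.
  move=> Lh Lx; have := plays_rcons Lh Lx.
  have [p pE] := history_nth (rcons h x) A.
  move: pE; rewrite size_rcons mkseqS => /rcons_inj[hE xE].
  rewrite {1}hE {1}xE -mkseqS => /plays_mkseq Lp.
  have [+ _] := tP p; move=> /(_ (size h)).
  rewrite /legalII posE mkseqS -hE -xE; apply=> m mh.
  by rewrite /legalI posE; exact: Lp.
(* [O h b C]: after the moves h, player I can force II to answer with b and a
   set below C.  Unlike being below I's move, this depends on C only through
   [b,C], which is what A3(2) controls. *)
pose O h b C := exists x, [/\ L h x, (t (rcons h x)).1 = b & le (t (rcons h x)).2 C].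
(* [O h b] may be lost when its set shrinks, so it is required hereditarily. *)
pose good h b C := forall D, le D C -> basic b D !=set0 -> O h b D.
have goodS h b C C' : le C' C -> good h b C -> good h b C'.
  by move=> C'C g D DC'; apply: g; exact: le_trans C'C.
pose W b h C := [/\ plays L h, (cur h).1 = b &
  forall b', next (lh r b).+1 b C b' -> good h b' C].
(* The inclusion makes every member of [[b,C]] a legal move of I; A3(2) supplies this inclusion
   rather than [C] being below the set of II. *)
have decide b h C e : plays L h -> (cur h).1 = b ->
    basic b C `<=` basic b (cur h).2 -> depth C b = Some e ->
    exists C', basicn e C C' /\ W b h C'.
  move=> Lh hb bC Cb.
  have [||C1 [CC1 C1P]] := @fusion_dense (fun b C => O h b C -> good h b C) b C e _ _ Cb.
  - move=> b' D D' D'D DP [x [? ? xD']]; apply: goodS (D'D) _; apply: DP.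
    by exists x; split=> //; exact: le_trans D'D.
  - move=> b' D e' Db'; have [g|] := pselect (good h b' D).
      by exists D; split=> //; exact: basicn_refl.
    move=> /existsNP[D1 /not_implyP[D1D /not_implyP[b'D1 nO]]].
    (* On [D2] the property [O] fails: a set answered below [D2] would belong to [[b',D2]], hence to
       [[b',D1]], and so lie below [D1]. *)
    have [D2 [DD2 b'D2 D21]] := basic_refine D1D b'D1 Db'.
    exists D2; split=> // -[x [Lx xb' xD2]]; case: nO; exists x; split=> //.
    apply: (@basic_le b'); apply: D21; split=> //.
    by have [_ [_]] := tL _ _ Lh Lx; rewrite xb'.
  have C1b := depth_basicn CC1 Cb.
  (* If A4 avoided O, player I could play inside C2 and II would still answer
     inside O. *)
  pose S := [set b' | AR_ r (lh r b).+1 b' /\ ~ O h b' C1].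
  have [|C2 [C12 C2P]] := @hA4 C1 b e S C1b; first by move=> b' [].
  have C2C1 := basicn_le C12.
  exists C2; split; first exact: basicn_trans C12.
  split=> // b' b'C2; case: C2P => [/= bad|/(_ _ b'C2) nS].
    have C2b : ARup C2 b.
      by have /depthP[? _] := depth_basicn C12 C1b; exists e.
    have [x bx] := basic_nonempty C2b.
    have Lx : L h x.
      rewrite /L hb; apply: bC; apply: basicS bx.
      exact: le_trans C2C1 (basicn_le CC1).
    have [tx1 tx2] := tL _ _ Lh Lx.
    have [] := bad (t (rcons h x)).1.
      by rewrite -hb; apply: nextS tx1; exact: basic_le bx.
    move=> _ []; exists x; split=> //.
    exact: le_trans (basic_le tx2) (le_trans (basic_le bx) C2C1).
  have [b'up bb' lb'] := b'C2.
  apply: goodS (C2C1) _; apply: C1P.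
  - by case: bb' => D [i [j [ij [-> ->]]]]; exact: initial_approx.
  - exact: ARup_le C2C1 b'up.
  - apply: contrapT => nO; apply: nS; split=> //.
    by case: bb' lb' => D [i [j [_ [_ ->]]]] <-; exists D; rewrite lh_approx.
have [//|C0 [AC0 W0]] := decide a [::] A d (@plays_nil _ _) erefl _ Ad.
have [||C [C0C CP]] := @fusion_branches _ W a C0 d _ _ (depth_basicn AC0 Ad) W0.
- move=> b h C C' C'C [Lh hb bC]; split=> // b' b'C'.
  by apply: goodS (C'C) _; apply: bC; exact: nextS C'C _ b'C'.
- move=> b h C b' e [Lh hb bC] b'C Cb'; have [b'up _ _] := b'C.
  (* [good] applied to [C] itself gives a move of I that provokes [b'] with a set below [C]; A3(2)
     then shrinks [C] so that [decide] applies at the new position. *)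
  have [x [Lx xb' xC]] := bC _ b'C C (le_refl C) (basic_nonempty b'up).
  have Lhx := plays_rcons Lh Lx.
  have [_ b'x] := tL _ _ Lh Lx.
  have b'x2 : basic b' (t (rcons h x)).2 !=set0.
    exists (t (rcons h x)).2; rewrite -xb'; split=> //.
    by exists (lh r (t (rcons h x)).1); exact: basic_lh b'x.
  have [C1 [CC1 _ C1x]] := basic_refine xC b'x2 Cb'.
  have [||C2 [C12 W2]] := decide b' (rcons h x) C1 e Lhx _ _ (depth_basicn CC1 Cb').
  + by rewrite cur_rcons.
  + by rewrite cur_rcons.
  by exists x, C2; split=> //; exact: basicn_trans C12.
exists C; split; first exact: basicn_trans C0C.
move=> D /CP[p pP]; have [_ []] := tP p.
  move=> n; rewrite /legalI posE.
  by have [/plays_mkseq/(_ n (ltnSn n))] := pP n.+1.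
move=> E [pE YE]; suff <- : E = D by [].
by apply: outcome_unique pE => n; rewrite posE; case: (pP n).
Qed.

(** * Copying strategies *)

Lemma I_reaches_of_subset a A Y : basic a A A -> basic a A `<=` Y ->
  I_reaches le r lefin a A Y.
Proof.
(* I repeats the last set played by II, or [A] in the first round. *)
move=> aA AY; exists (fun h => (last (a, A) h).2) => q p.
have posE n : p n = (pos a A q n).2.
  by case: n => [|n] //; rewrite /p mkseqS last_rcons.
have legal n : (forall m, m < n -> legalII le r lefin a A p q m) ->
    legalI le r a A p q n.
  rewrite /legalI posE; case: n => [|n] //= /(_ n (ltnSn n))[_ bn].
  by split=> //; exists (lh r (q n).1); exact: basic_lh bn.
split=> // IIq; have Ip n : legalI le r a A p q n by exact: legal.
have aup : ARup A a by exact: basic_ARup aA.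
have [B qB] := hout aup Ip IIq.
by exists B; split=> //; apply: AY; exact: basic_of_outcome aA Ip IIq qB.
Qed.

Lemma II_reaches_of_subset a A Y : basic a A A -> basic a A `<=` Y ->
  II_reaches le r lefin a A Y.
Proof.
move=> aA AY.
(* II returns the set of I with its next approximation; [h] includes the current move, so its size
   in round [n] is [n.+1]. *)
exists (fun h => (r (last A h) (lh r a + size h), last A h)) => p q.
have qE n : q n = (r (p n) (lh r a + n.+1), p n).
  by rewrite /q mkseqS last_rcons size_rcons size_mkseq.
have Aa := basic_lh aA.
have posE n : exists B, pos a A q n = (r B (lh r a + n), B).
  case: n => [|n]; first by exists A; rewrite addn0 Aa.
  by exists (p n); rewrite /= qE.
have legal n : legalI le r a A p q n -> legalII le r lefin a A p q n.
  rewrite /legalI /legalII; have [B ->] := posE n; rewrite qE /= addnS.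
  move=> [_ bp]; have pp : basic (r B (lh r a + n)) (p n) (p n) by split.
  split; first by have := nextP pp; rewrite lh_approx.
  by split=> //; exists (lh r a + n).+1.
split=> [n /(_ n (leqnn n))|Ip]; first exact: legal.
have IIq n : legalII le r lefin a A p q n by exact: legal.
have aup : ARup A a by exact: basic_ARup aA.
have [B qB] := hout aup Ip IIq.
by exists B; split=> //; apply: AY; exact: basic_of_outcome aA Ip IIq qB.
Qed.

(** * The two implications *)

Lemma basic_self a A B : basic a A B -> basic a B B.
Proof. by move=> [_ ?]; split. Qed.

Lemma Ramsey_of_Kastanas X : KastanasRamsey le r lefin X -> Ramsey le r lefin X.
Proof.
move=> KX A a aA; have [B [aB BX]] := KX A a aA.
have aBB := basic_self aB.
have [d Bd] := ARup_depth (basic_ARup aBB).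
(* [C] shares [r B d] with [B] but need not pass through [a], so it is replaced by a member of
   [[a,C]]. *)
have cone Y : (exists C, basicn d B C /\ basic a C `<=` Y) ->
    exists2 D, basic a A D & basic a D `<=` Y.
  move=> [C [BC CY]].
  have [|D aD] := @basic_nonempty a C.
    by have /depthP[? _] := depth_basicn BC Bd; exists d.
  exists D; last exact: subset_trans (basicS aD.1) CY.
  apply: basicS aD; exact: le_trans BC.1 aB.1.
case: BX => [I|II].
  have [D aD DX] := cone _ (Ramsey_of_I_reaches aBB Bd I).
  by exists D; split=> //; right.
have [D aD DX] := cone _ (Ramsey_of_II_reaches aBB Bd II).
by exists D; split=> //; left.
Qed.

Lemma Kastanas_of_Ramsey X : Ramsey le r lefin X -> KastanasRamsey le r lefin X.
Proof.
move=> RX A a aA; have [B [aB BX]] := RX A a aA; exists B; split=> //.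
have aBB := basic_self aB.
case: BX => BX; first by right; exact: II_reaches_of_subset.
by left; exact: I_reaches_of_subset.
Qed.

End RamseySpace.

Theorem theorem1p1 (R AR : Type) (le : R -> R -> Prop) (r : R -> nat -> AR)
    (lefin : AR -> AR -> Prop)
    (R_nonempty : inhabited R) (le_quasiorder : PreOrder le)
    (hA1 : A1 r) (hA2 : A2 le r lefin) (hA3 : A3 le r lefin)
    (hA4 : A4 le r lefin) (hout : outcomes_exist le r lefin) (X : set R) :
  KastanasRamsey le r lefin X <-> Ramsey le r lefin X.
Proof.
by split; [exact: Ramsey_of_Kastanas|exact: Kastanas_of_Ramsey].
Qed.
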